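(* Let $X$ be a set, let $B(X)$ be the set of all real-valued bounded functions on $X$, let $(a_n)_{n\ge0}$ be real numbers with $\sum_{n=0}^\infty|a_n|<\infty$ and $\sum_{n=0}^\infty a_n=1$, and let $(x_n)_{n\ge 0}$ be mutually distinct points of $X$. For $f\in B(X)$ put $f_n:=f(x_n)$ and $L(f):=\sum_{n=0}^\infty a_nf_n$. Then for all $f,g\in B(X)$, $$\left|L(fg)-L(f)\cdot L(g)\right|\le osc_L(f)\cdot osc_L(g)\cdot\sum_{0\le n<m<\infty}|a_na_m|,$$ where $osc_L(f):=\sup\{|f_n-f_m|:0\le n<m<\infty\}$ and $osc_L(g):=\sup\{|g_n-g_m|:0\le n<m<\infty\}$.
   Context: The functional $L:B(X)\to\mathbb{R}$ is linear but not necessarily positive. *)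

(* Defs.v *)
From mathcomp Require Import all_boot all_order all_algebra.
From mathcomp Require Import all_classical all_reals all_analysis.
Import Order.TTheory GRing.Theory Num.Theory numFieldNormedType.Exports.

Set Implicit Arguments.
Unset Strict Implicit.
Unset Printing Implicit Defensive.

Local Open Scope classical_set_scope.
Local Open Scope ring_scope.

Definition ltn_pairs : set (nat * nat) := [set p | (p.1 < p.2)%N].

Definition L_fun (R : realType) (X : Type) (a : nat -> R) (x : nat -> X)
    (f : X -> R) : R :=
  limn (series (fun n => a n * f (x n))).

(* The supremum is taken in R: for bounded f the set is bounded, and it is
   never empty. *)
Definition osc_L (R : realType) (X : Type) (x : nat -> X) (f : X -> R) : R :=
  sup [set `|f (x p.1) - f (x p.2)| | p in ltn_pairs].

(* Main.v *)
(* Korkine's identity for the partial sums: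
     (sum a_i) (sum a_i f_i g_i) - (sum a_i f_i) (sum a_i g_i)
       = sum_(i < j) a_i a_j (f_i - f_j) (g_i - g_j).
   Each summand on the right is at most osc f * osc g * |a_i a_j|, and the left
   side tends to L(fg) - L(f) L(g) because the a_n sum to 1. *)
Require Import Defs.
From mathcomp Require Import all_boot all_order all_algebra.
From mathcomp Require Import all_classical all_reals all_analysis.
From mathcomp Require Import ring.
Import Order.TTheory GRing.Theory Num.Theory numFieldNormedType.Exports.

Local Open Scope classical_set_scope.
Local Open Scope ring_scope.

Lemma Korkine_identity (R : comPzRingType) (a u v : nat -> R) (N : nat) :
  (\sum_(0 <= i < N) a i) * (\sum_(0 <= i < N) a i * (u i * v i))
    - (\sum_(0 <= i < N) a i * u i) * (\sum_(0 <= i < N) a i * v i)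
  = \sum_(0 <= j < N) \sum_(0 <= i < j)
      a i * a j * ((u i - u j) * (v i - v j)).
Proof.
elim: N => [|N IHN]; first by rewrite !big_nil !mul0r subr0.
rewrite [RHS]big_nat_recr //= -IHN.
(* Expanding the product writes the new column [j = N] through the four partial sums up to [N],
   which [ring] then treats as atoms. *)
have -> : \sum_(0 <= i < N) a i * a N * ((u i - u N) * (v i - v N)) =
    a N * (\sum_(0 <= i < N) a i * (u i * v i)
           + u N * v N * \sum_(0 <= i < N) a i
           - v N * (\sum_(0 <= i < N) a i * u i)
           - u N * \sum_(0 <= i < N) a i * v i).
  rewrite !mulr_sumr -big_split /= -sumrB -sumrB mulr_sumr.
  by apply: eq_bigr => i _; ring.
by rewrite !big_nat_recr //=; ring.
Qed.

(** [\esum] is a supremum over finite subsets, and the triangle [i < j < N] is one of them. *)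
Lemma sum_pairs_le_esum (R : realType) (F : nat * nat -> \bar R) (N : nat) :
  (\sum_(0 <= j < N) \sum_(0 <= i < j) F (i, j)
   <= \esum_(p in ltn_pairs) F p)%E.
Proof.
pose s := [seq (i, j) | j <- index_iota 0 N, i <- index_iota 0 j].
have s_uniq : uniq s.
  apply: allpairs_uniq_dep; [exact: iota_uniq | by move=> j _; exact: iota_uniq|].
  by move=> [j i] [j' i'] _ _ /= [-> ->].
apply: esum_ge; exists [set` s].
  split; first exact: finite_seq.
  move=> p /= /allpairsPdep[j [i [_]]].
  by rewrite mem_index_iota => /= ij ->.
by rewrite -fsbig_seq// big_allpairs_dep.
Qed.

Lemma bounded_fun_ex_bound (R : realType) (X : Type) (f : X -> R) :
  bounded_fun f -> exists M : R, forall y, `|f y| <= M.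
Proof.
(* [bounded_fun] speaks of bounds near [+oo]: only values strictly above [M] are known to work,
   hence [M + 1]. *)
move=> [M [_ fM]]; exists (M + 1) => y.
by apply: (fM (M + 1)) => //; rewrite ltrDl.
Qed.

Lemma osc_L_ge (R : realType) (X : Type) (x : nat -> X) (f : X -> R)
    (i j : nat) : bounded_fun f -> (i < j)%N ->
  `|f (x i) - f (x j)| <= osc_L x f.
Proof.
move=> /bounded_fun_ex_bound[M fM] ij; apply: ub_le_sup; last by exists (i, j).
exists (M + M) => _ [p _ <-].
by apply: le_trans (ler_normB _ _) _; apply: lerD; exact: fM.
Qed.

Lemma osc_L_ge0 (R : realType) (X : Type) (x : nat -> X) (f : X -> R) :
  bounded_fun f -> 0 <= osc_L x f.
Proof.
move=> fb; exact: le_trans (normr_ge0 _) (osc_L_ge R X x f 0 1 fb isT).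
Qed.

(** Comparison with [M * |a n|]. This makes each [limn] in [L_fun] a genuine limit and not a default
    value. *)
Lemma cvg_series_mul_bounded (R : realType) (a u : nat -> R) (M : R) :
  (\sum_(0 <= n <oo) `|a n|%:E < +oo)%E -> (forall n, `|u n| <= M) ->
  cvgn (series (fun n => a n * u n)).
Proof.
move=> a_abs uM; apply: normed_cvg.
have M0 : 0 <= M := le_trans (normr_ge0 _) (uM 0).
(* Back from the extended reals: the partial sums increase and are bounded by the real value of the
   finite sum. *)
have a_cvg : cvgn [normed series a].
  apply: nondecreasing_is_cvgn.
    by apply: nondecreasing_series => n _ _; exact: normr_ge0.
  exists (fine (\sum_(0 <= n <oo) `|a n|%:E)%E) => _ [N _ <-].
  rewrite -lee_fin fineK; last first.
    by rewrite ge0_fin_numE//; apply: nneseries_ge0.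
  by rewrite /series /= -sumEFin; apply: nneseries_lim_ge.
apply: (@series_le_cvg _ _ (M *: (fun n => `|a n|))).
- by move=> n; exact: normr_ge0.
- by move=> n; rewrite mulr_ge0.
- by move=> n; rewrite /= normrM mulrC ler_wpM2r.
- exact: is_cvg_seriesZ.
Qed.

Theorem theorem2p3 (R : realType) (X : Type) (a : nat -> R) (x : nat -> X)
    (a_abs : (\sum_(0 <= n <oo) `|a n|%:E < +oo)%E)
    (a_sum : series a @ \oo --> (1 : R))
    (x_inj : injective x)
    (f g : X -> R) (f_bnd : bounded_fun f) (g_bnd : bounded_fun g) :
  (`|L_fun a x (f \* g) - L_fun a x f * L_fun a x g|%:E
   <= (osc_L x f * osc_L x g)%:E
      * \esum_(p in ltn_pairs) `|a p.1 * a p.2|%:E)%E.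
Proof.
have [Mf fM] := bounded_fun_ex_bound _ _ _ f_bnd.
have [Mg gM] := bounded_fun_ex_bound _ _ _ g_bnd.
have f_cvg : cvgn (series (fun n => a n * f (x n))).
  exact: (cvg_series_mul_bounded _ _ _ Mf).
have g_cvg : cvgn (series (fun n => a n * g (x n))).
  exact: (cvg_series_mul_bounded _ _ _ Mg).
have fg_cvg : cvgn (series (fun n => a n * (f (x n) * g (x n)))).
  apply: (cvg_series_mul_bounded _ _ _ (Mf * Mg)) => // n.
  by rewrite normrM ler_pM.
(* The factor [series a N], in general not 1 at finite [N], gives [D N] the exact shape of Korkine's
   identity; in the limit it becomes the 1 inserted by [mul1r] below. *)
pose D N := series a N * series (fun n => a n * (f (x n) * g (x n))) N
  - series (fun n => a n * f (x n)) N * series (fun n => a n * g (x n)) N.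
have D_cvg : `|D N| @[N --> \oo] -->
    `|L_fun a x (f \* g) - L_fun a x f * L_fun a x g|.
  apply: cvg_norm; rewrite -[L_fun a x (f \* g)]mul1r.
  by apply: cvgB; apply: cvgM.
(* The right side does not depend on [N], so bounding every [|D N|] by it suffices. *)
apply: (@cvge_to_le _ \oo _ _ (fun N => `|D N|%:E)).
  by apply: cvg_EFin; [exact: nearW | exact: D_cvg].
apply: nearW => N; set c := osc_L x f * osc_L x g.
have c_ge0 : 0 <= c by rewrite mulr_ge0 ?osc_L_ge0.
apply: (@le_trans _ _ (c%:E *
    (\sum_(0 <= j < N) \sum_(0 <= i < j) `|a i * a j|%:E))%E); last first.
  rewrite lee_wpmul2l ?lee_fin//.
  exact: (sum_pairs_le_esum _ (fun p => `|a p.1 * a p.2|%:E)).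
under eq_bigr do rewrite sumEFin.
rewrite sumEFin -EFinM lee_fin /D /series /= Korkine_identity.
rewrite mulr_sumr (le_trans (ler_norm_sum _ _ _))//; apply: ler_sum => j _.
rewrite mulr_sumr (le_trans (ler_norm_sum _ _ _))//.
(* [big_nat] exposes the range condition [i < j], which [osc_L_ge] requires. *)
rewrite big_nat [leRHS]big_nat; apply: ler_sum => i /andP[_ ij].
rewrite normrM mulrC ler_wpM2r// normrM.
by rewrite ler_pM//; apply: osc_L_ge.
Qed.
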